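(* Let $\mathcal{H}$ be a finite-dimensional Hilbert space, $\rho_0,\rho_1,\sigma_0,\sigma_1$ density operators on $\mathcal{H}$, and $0\le\lambda\le1$. Then $$\lambda\,\mathrm{D}^{R}(\rho_0\|\sigma_0)+(1-\lambda)\,\mathrm{D}^{R}(\rho_1\|\sigma_1)\ \ge\ \mathrm{D}^{R}\big(\lambda\rho_0+(1-\lambda)\rho_1\,\big\|\,\lambda\sigma_0+(1-\lambda)\sigma_1\big),$$ where $\mathrm{D}^{R}(\rho\|\sigma)=\mathrm{tr}\,\rho\ln\left(\sqrt{\rho}\,\sigma^{-1}\sqrt{\rho}\right)$.
   Context: In $\mathrm{D}^{R}$, $\sigma^{-1}$ is the generalized (Moore–Penrose) inverse and the logarithm is taken on $\mathrm{supp}\,\rho$; $\mathrm{D}^{R}(\rho\|\sigma)=+\infty$ if $\mathrm{supp}\,\rho\not\subset\mathrm{supp}\,\sigma$. The convention $0\cdot(+\infty)=0$ is used when $\lambda\in\{0,1\}$. *)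

(* Defs.v *)
From HB Require Import structures.
From mathcomp Require Import all_boot all_order all_algebra.
From mathcomp Require Import spectral complex.
From mathcomp Require Import boolp reals constructive_ereal exp.

Set Implicit Arguments.
Unset Strict Implicit.
Unset Printing Implicit Defensive.

Import Order.TTheory GRing.Theory Num.Theory.

Local Open Scope ring_scope.
Local Open Scope sesquilinear_scope.

(* Operators on the Hilbert space C^n are n x n matrices. As usual in MathComp,
   vectors are row vectors, the operator A is u |-> u *m A, and the inner
   product of u and v is dotmx u v = (u *m v ^t* ) 0 0. *)

Section Operators.
Variables (C : numClosedFieldType) (n : nat).
Implicit Types A X : 'M[C]_n.

Definition psdmx A : Prop :=
  A \is hermsymmx /\ forall u : 'rV[C]_n, 0 <= dotmx (u *m A) u.

Definition density_operator A : Prop := psdmx A /\ \tr A = 1.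

(* The orthogonal complement of the kernel, given as a row space. *)
Definition supp A : 'M[C]_n := orthomx Num.conj 1%:M (kermx A).

(* f(A) = sum_i f(a_i) |e_i><e_i| for a normal A with orthonormal eigenbasis
   (e_i) and eigenvalues a_i. The choice of the eigenbasis is immaterial: see
   mxfunE. *)
Definition mxfun (f : C -> C) A : 'M[C]_n :=
  invmx (spectralmx A) *m diag_mx (map_mx f (spectral_diag A))
  *m spectralmx A.

Definition sqrt_op A := mxfun sqrtC A.

(* As 0^-1 = 0, this inverts A on its support and vanishes on its kernel: see
   ginv_moore_penrose and moore_penrose_unique. *)
Definition ginv_op A := mxfun GRing.inv A.

Definition moore_penrose A X : Prop :=
  [/\ A *m X *m A = A, X *m A *m X = X,
      (A *m X) ^t* = A *m X & (X *m A) ^t* = X *m A].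

End Operators.

Section RelativeEntropy.
Variables (R : realType) (n : nat).
Implicit Types A rho sigma : 'M[R[i]]_n.

(* As ln 0 = 0, this is, for A positive semidefinite, the logarithm taken on
   supp A, extended by 0 on the kernel. The eigenvalues of A are then real, so
   that Re and %:C only change their types. *)
Definition ln_op A := mxfun (fun z : R[i] => (ln (complex.Re z))%:C%C) A.

(* When supp rho <= supp sigma, the argument of ln_op is positive semidefinite
   with the same support as rho (see supp_sandwich), so that the logarithm is
   taken on supp rho. The trace is a real number. *)
Definition DR rho sigma : \bar R :=
  if (supp rho <= supp sigma)%MS then
    (complex.Re (\tr (rho *m
       ln_op (sqrt_op rho *m ginv_op sigma *m sqrt_op rho))))%:E
  else +oo%E.

End RelativeEntropy.

Section Diagonalisation.
Variables (F : fieldType) (n : nat) (g : F -> F).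
Implicit Types (P Q : 'M[F]_n) (a b : 'rV[F]_n).

Lemma conj_diagM P a b : P \in unitmx ->
  (invmx P *m diag_mx a *m P) *m (invmx P *m diag_mx b *m P)
  = invmx P *m diag_mx (\row_i (a 0 i * b 0 i)) *m P.
Proof.
move=> Pu; rewrite !mulmxA mulmxK // -(mulmxA (invmx P)) mulmx_diag.
by [].
Qed.

Lemma conj_diag_map P Q a b : P \in unitmx -> Q \in unitmx ->
  invmx P *m diag_mx a *m P = invmx Q *m diag_mx b *m Q ->
  invmx P *m diag_mx (map_mx g a) *m P = invmx Q *m diag_mx (map_mx g b) *m Q.
Proof.
move=> Pu Qu PQ.
have aWb : diag_mx a *m (P *m invmx Q) = (P *m invmx Q) *m diag_mx b.
  have -> : diag_mx a = P *m (invmx P *m diag_mx a *m P) *m invmx P.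
    by rewrite !mulmxA mulmxK // mulmxV // mul1mx.
  by rewrite PQ !mulmxA mulmxKV // mulmxK.
have gaWb : diag_mx (map_mx g a) *m (P *m invmx Q)
          = (P *m invmx Q) *m diag_mx (map_mx g b).
  move/matrixP: aWb => aWb; apply/matrixP => i j; move: (aWb i j).
  rewrite !mul_diag_mx !mul_mx_diag !mxE.
  set w := (\sum_k _); have [->|w0] := eqVneq w 0; first by rewrite !mulr0 !mul0r.
  by rewrite [RHS]mulrC => /(mulIf w0) ->; rewrite mulrC.
have -> : diag_mx (map_mx g a)
    = P *m invmx Q *m diag_mx (map_mx g b) *m (Q *m invmx P).
  by rewrite -gaWb !mulmxA mulmxKV // mulmxK.
by rewrite !mulmxA mulVmx // mul1mx mulmxKV.
Qed.

End Diagonalisation.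

Section Facts.
Variables (C : numClosedFieldType) (n : nat).
Implicit Types A B X : 'M[C]_n.

Lemma adjM m p q (A : 'M[C]_(m, p)) (B : 'M[C]_(p, q)) :
  (A *m B) ^t* = B ^t* *m A ^t*.
Proof. by rewrite trmx_mul map_mxM. Qed.

Lemma hermP A : reflect (A ^t* = A) (A \is hermsymmx).
Proof.
apply: (iffP (is_hermitianmxP _ _ _)); rewrite expr0 scale1r => eA.
  by rewrite -eA.
by rewrite eA.
Qed.

Lemma mxfunE (f : C -> C) A (P : 'M[C]_n) (d : 'rV[C]_n) :
  A \is normalmx -> P \in unitmx -> A = invmx P *m diag_mx d *m P ->
  mxfun f A = invmx P *m diag_mx (map_mx f d) *m P.
Proof.
move=> /orthomx_spectralP sA Pu dA.
by apply: conj_diag_map; rewrite ?spectral_unit // -sA.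
Qed.

Lemma supp_herm A : A \is hermsymmx -> (supp A :=: A)%MS.
Proof.
move=> /hermP hA; apply/eqmxP; rewrite andbC.
have sub : (A <= supp A)%MS.
  by apply/orthomx1P; rewrite -{1}hA -adjM mulmx_ker trmx0 map_mx0.
rewrite sub -(geq_leqif (mxrank_leqif_sup sub)).
by rewrite rank_ortho mxrank_ker subKn ?rank_leq_row //=.
Qed.

Lemma mxfunM f g A : mxfun f A *m mxfun g A = mxfun (fun x => f x * g x) A.
Proof.
apply: etrans (conj_diagM _ _ (spectral_unit A)) _.
by congr (_ *m diag_mx _ *m _); apply/rowP => j; rewrite !mxE.
Qed.

Lemma herm_spectral_real A i : A \is hermsymmx ->
  spectral_diag A 0 i \is Num.real.
Proof. by move=> /hermitian_spectral_diag_real /mxOverP. Qed.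

Lemma eq_mxfun f g A :
  (forall i, f (spectral_diag A 0 i) = g (spectral_diag A 0 i)) ->
  mxfun f A = mxfun g A.
Proof.
move=> fg; rewrite /mxfun; congr (_ *m diag_mx _ *m _).
by apply/rowP => j; rewrite !mxE.
Qed.

Lemma mxfun_id A : A \is hermsymmx -> mxfun id A = A.
Proof.
move=> hA; rewrite [RHS](orthomx_spectralP (hermitian_normalmx hA)) /mxfun.
by rewrite map_mx_id.
Qed.

Lemma mxfun_herm f A :
  (forall i, f (spectral_diag A 0 i) \is Num.real) -> mxfun f A \is hermsymmx.
Proof.
move=> fR; apply/hermP; rewrite /mxfun invmx_unitary ?spectral_unitarymx //.
rewrite !adjM trmxCK mulmxA; congr (_ *m _ *m _).
rewrite tr_diag_mx map_diag_mx; congr diag_mx; apply/rowP => j.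
by rewrite !mxE; exact: conj_Creal.
Qed.

Lemma ginv_moore_penrose A : A \is hermsymmx -> moore_penrose A (ginv_op A).
Proof.
move=> hA; have aR i := herm_spectral_real i hA.
have xx (x : C) : x * x^-1 * x = x.
  by have [->|x0] := eqVneq x 0; rewrite ?mulr0 // mulfVK.
have xV (x : C) : x^-1 * x * x^-1 = x^-1.
  by have [->|x0] := eqVneq x 0; rewrite ?invr0 ?mulr0 // mulVf // mul1r.
have AG : A *m ginv_op A = mxfun (fun x => x * x^-1) A.
  by rewrite -[X in X *m _](mxfun_id hA); exact: mxfunM.
have GA : ginv_op A *m A = mxfun (fun x => x^-1 * x) A.
  by rewrite -[X in _ *m X](mxfun_id hA); exact: mxfunM.
split; rewrite ?AG ?GA.
- rewrite -[X in _ *m X](mxfun_id hA) -[RHS](mxfun_id hA).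
  by apply: etrans (mxfunM _ _ _) _; exact: eq_mxfun.
- by apply: etrans (mxfunM _ _ _) _; exact: eq_mxfun.
- by apply/hermP/mxfun_herm => i; rewrite realM ?realV.
- by apply/hermP/mxfun_herm => i; rewrite realM ?realV.
Qed.

Lemma moore_penrose_unique A X Y :
  moore_penrose A X -> moore_penrose A Y -> X = Y.
Proof.
move=> [x1 x2 x3 x4] [y1 y2 y3 y4].
have e1 : A *m X = A *m Y.
  by rewrite -x3 -{1}y1 -mulmxA adjM x3 y3 mulmxA x1.
have e2 : X *m A = Y *m A.
  by rewrite -x4 -{1}y1 !mulmxA -mulmxA adjM x4 y4 -mulmxA (mulmxA A) x1.
by rewrite -x2 -mulmxA e1 mulmxA e2 y2.
Qed.

Lemma psd_spectral_ge0 A i : psdmx A -> 0 <= spectral_diag A 0 i.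
Proof.
move=> [hA /(_ (row i (spectralmx A)))]; set Q := spectralmx A.
have eA : Q *m A = diag_mx (spectral_diag A) *m Q.
  rewrite [X in _ *m X = _](orthomx_spectralP (hermitian_normalmx hA)) !mulmxA.
  by rewrite mulmxV ?spectral_unit // mul1mx.
rewrite -row_mul eA row_mul row_diag_mx -scalemxAl -rowE linearZl_LR /=.
have /row_unitarymxP/(_ i i) -> := spectral_unitarymx A.
by rewrite eqxx mulr1.
Qed.

Lemma supp_sandwich A B : psdmx A -> psdmx B -> (supp A <= supp B)%MS ->
  (supp (sqrt_op A *m ginv_op B *m sqrt_op A) :=: supp A)%MS.
Proof.
move=> pA pB; have [hA _] := pA; have [hB _] := pB.
have [b1 _ b3 _] := ginv_moore_penrose hB.
rewrite (supp_herm hA) (supp_herm hB) => sAB.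
set S := sqrt_op A; set G := ginv_op B in b1 b3 *.
set T := mxfun (fun x : C => sqrtC x^-1) B; set M := S *m G *m S.
have hS : S ^t* = S.
  apply/hermP/mxfun_herm => i.
  by rewrite ger0_real // sqrtC_ge0 psd_spectral_ge0.
have hT : T ^t* = T.
  apply/hermP/mxfun_herm => i.
  by rewrite ger0_real // sqrtC_ge0 invr_ge0 psd_spectral_ge0.
have SS : A = S *m S.
  rewrite -[LHS](mxfun_id hA) mxfunM; apply: eq_mxfun => i.
  by rewrite -expr2 sqrtCK.
have TT : G = T *m T.
  by rewrite mxfunM; apply: eq_mxfun => i; rewrite -expr2 sqrtCK.
have SA : (S <= A)%MS.
  apply/submxP; exists (mxfun (fun x : C => sqrtC x * x^-1) A).
  rewrite -[X in _ *m X](mxfun_id hA) mxfunM; apply: eq_mxfun => i /=.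
  set x := spectral_diag A 0 i.
  by have [->|x0] := eqVneq x 0; rewrite ?sqrtC0 ?mul0r // mulfVK.
clearbody S T G; have hM : M \is hermsymmx.
  by apply/hermP; rewrite /M TT !adjM hS hT !mulmxA.
have MS : (M <= A)%MS by rewrite (submx_trans _ SA) // submxMl.
have kMA : (kermx M <= kermx A)%MS.
  apply/rV_subP => u /sub_kermxP uM; apply/sub_kermxP.
  have uST : u *m S *m T = 0.
    have d0 : dotmx (u *m S *m T) (u *m S *m T) = 0.
      rewrite dotmxE !adjM hS hT !mulmxA.
      have -> : u *m S *m T *m T *m S = u *m M by rewrite /M TT !mulmxA.
      by rewrite uM mul0mx mxE.
    by apply/eqP; rewrite -(dnorm_eq0 (@dotmx C n)); apply/eqP.
  have /submxP[D SD] : (S <= B)%MS by exact: submx_trans sAB.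
  have SGB : S *m G *m B = S by rewrite SD -!mulmxA (mulmxA B) b1.
  by rewrite SS -SGB TT !mulmxA uST !mul0mx.
have rAM : (\rank A <= \rank M)%N.
  move/mxrankS: kMA; rewrite !mxrank_ker.
  by rewrite leq_sub2lE ?rank_leq_row.
apply: (eqmx_trans (supp_herm hM)); apply: eqmx_trans (eqmx_sym (supp_herm hA)).
by apply/eqmxP; rewrite MS -(geq_leqif (mxrank_leqif_sup MS)).
Qed.

End Facts.

(* Main.v *)
Require Import Defs.
From HB Require Import structures.
From mathcomp Require Import all_boot all_order all_algebra.
From mathcomp Require Import spectral complex ring.
From mathcomp Require Import boolp reals constructive_ereal exp.
From mathcomp Require Import realfun derive normedtype topology.

(* Write tr rho ln M, with M = sqrt rho sigma^-1 sqrt rho, as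
   sum_i w_i ln mu_i over the eigenvalues mu_i of M, where sum_i w_i = tr rho.
   For s > 0, sum_i w_i / (mu_i + s) = tr rho (M + s)^-1 is the trace of the
   parallel sum of sigma and rho / s, which is
   min_U tr U^* sigma U + s^-1 tr (1 - U)^* rho (1 - U), hence jointly concave
   in (rho, sigma). So the convexity defect sum_j c_j ln (l_j + s), at s = 0, of
   the entropies is the value at 0 of a nondecreasing function of s that tends
   to 0 at +oo, and is therefore nonpositive. *)

Set Implicit Arguments.
Unset Strict Implicit.
Unset Printing Implicit Defensive.
Import Order.TTheory GRing.Theory Num.Theory.

Local Open Scope ring_scope.
Local Open Scope complex_scope.

Local Open Scope sesquilinear_scope.

(** * Positive semidefinite operators, their square roots and kernels *)

Section PositiveOperators.
Variables (C : numClosedFieldType) (n : nat).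
Implicit Types A B D M T U X : 'M[C]_n.

Lemma adjD m p (A B : 'M[C]_(m, p)) : (A + B) ^t* = A ^t* + B ^t*.
Proof. by rewrite linearD map_mxD. Qed.

Lemma adjB m p (A B : 'M[C]_(m, p)) : (A - B) ^t* = A ^t* - B ^t*.
Proof. by rewrite linearB map_mxB. Qed.

Lemma adjZ m p (a : C) (A : 'M[C]_(m, p)) : (a *: A) ^t* = a^* *: A ^t*.
Proof. by rewrite linearZ map_mxZ. Qed.

Lemma adj1 : (1%:M : 'M[C]_n) ^t* = 1%:M.
Proof. by rewrite trmx1 map_mx1. Qed.

Lemma psd_gram T : psdmx (T *m T ^t*).
Proof.
split=> [|u]; first by apply/hermP; rewrite adjM trmxCK.
by rewrite dotmxE mulmxA -mulmxA -adjM -dotmxE dnorm_ge0.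
Qed.

Lemma psd_add A B : psdmx A -> psdmx B -> psdmx (A + B).
Proof.
move=> [/hermP hA pA] [/hermP hB pB]; split.
  by apply/hermP; rewrite adjD hA hB.
by move=> u; rewrite mulmxDr linearDl addr_ge0 ?pA ?pB.
Qed.

Lemma psd_scale (a : C) A : 0 <= a -> psdmx A -> psdmx (a *: A).
Proof.
move=> a0 [/hermP hA pA]; split.
  by apply/hermP; rewrite adjZ hA conj_Creal ?ger0_real.
by move=> u; rewrite -scalemxAr linearZl_LR /= mulr_ge0 ?pA.
Qed.

(** The diagonal entries of [D ^t* *m A *m D] are the values of the quadratic form of [A] at the
    rows of [D ^t*]. *)
Lemma psd_tr_ge0 A D : psdmx A -> 0 <= \tr (D ^t* *m A *m D).
Proof.
move=> [_ pA]; apply: sumr_ge0 => i _.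
have := pA (row i (D ^t*)); rewrite dotmxE -row_mul.
suff -> : (row i (D ^t* *m A) *m (row i (D ^t*)) ^t*) 0 0
  = (D ^t* *m A *m D) i i by [].
rewrite [LHS]mxE [RHS]mxE; apply: eq_bigr => j _.
by rewrite [X in X * _]mxE; congr (_ * _); rewrite !mxE conjCK.
Qed.

Lemma sqrt_op_herm A : psdmx A -> (sqrt_op A) ^t* = sqrt_op A.
Proof.
move=> pA; apply/hermP/mxfun_herm => i.
by rewrite ger0_real // sqrtC_ge0 psd_spectral_ge0.
Qed.

Lemma sqrt_opK A : psdmx A -> sqrt_op A *m sqrt_op A = A.
Proof.
move=> [hA _]; rewrite mxfunM -[RHS](mxfun_id hA); apply: eq_mxfun => i.
by rewrite -expr2 sqrtCK.
Qed.

Lemma sqrt_op_sub A : psdmx A -> (sqrt_op A <= A)%MS.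
Proof.
move=> [hA _]; apply/submxP.
(* On the spectrum, sqrt x = (sqrt x * x^-1) * x; at x = 0 both sides are 0. *)
exists (mxfun (fun x : C => sqrtC x * x^-1) A).
rewrite -[X in _ *m X](mxfun_id hA) mxfunM; apply: eq_mxfun => i /=.
set x := spectral_diag A 0 i.
by have [->|x0] := eqVneq x 0; rewrite ?sqrtC0 ?mul0r // mulfVK.
Qed.

(** The quadratic form of [A] at [u] is the squared norm of [u *m sqrt_op A]. *)
Lemma psd_dotmx_eq0 A (u : 'rV[C]_n) : psdmx A ->
  dotmx (u *m A) u = 0 -> u *m A = 0.
Proof.
move=> pA d0; rewrite -(sqrt_opK pA) mulmxA.
suff -> : u *m sqrt_op A = 0 by rewrite mul0mx.
apply/eqP; rewrite -(dnorm_eq0 (@dotmx C n)); apply/eqP; rewrite -[RHS]d0.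
rewrite [LHS]dotmxE [RHS]dotmxE adjM sqrt_op_herm //.
by rewrite -[X in _ = (u *m X *m _) _ _](sqrt_opK pA) !mulmxA.
Qed.

(** On the kernel of the sum, two nonnegative quadratic forms add up to 0, so each of them
    vanishes. *)
Lemma psd_ker_addl A B : psdmx A -> psdmx B -> (kermx (A + B) <= kermx A)%MS.
Proof.
move=> pA pB; apply/rV_subP => u /sub_kermxP uAB; apply/sub_kermxP.
apply: (psd_dotmx_eq0 pA); have [[_ /(_ u) a0] [_ /(_ u) b0]] := (pA, pB).
have := paddr_eq0 a0 b0; rewrite -linearDl -mulmxDr uAB linear0l eqxx.
by move/esym/andP=> [/eqP].
Qed.

(** Orthogonal complements reverse inclusions. Kernels are the convenient side for sums of positive
    operators. *)
Lemma supp_ker A B : (supp A <= supp B)%MS = (kermx B <= kermx A)%MS.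
Proof. exact: submx_ortho. Qed.

(** * The sandwiched operator, its resolvent and the parallel sum *)

Definition sandwich A B := sqrt_op A *m ginv_op B *m sqrt_op A.

Lemma psd_sandwich A B : psdmx A -> psdmx B -> psdmx (sandwich A B).
Proof.
(* [T] is the square root of the generalized inverse of [B], which exhibits the sandwich as a Gram
   matrix. *)
move=> pA pB; pose T := mxfun (fun x : C => sqrtC x^-1) B.
suff -> : sandwich A B = (sqrt_op A *m T) *m (sqrt_op A *m T) ^t*.
  exact: psd_gram.
have hT : T ^t* = T.
  apply/hermP/mxfun_herm => i.
  by rewrite ger0_real // sqrtC_ge0 invr_ge0 psd_spectral_ge0.
rewrite adjM hT sqrt_op_herm // mulmxA -(mulmxA _ T T); congr (_ *m _ *m _).
by rewrite mxfunM; apply: eq_mxfun => i; rewrite -expr2 sqrtCK.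
Qed.

(** This is (M + s)^-1, taken by functional calculus so that it shares with [ln_op M] the eigenbasis
    chosen for [M]. *)
Definition resolvent (s : C) M := mxfun (fun z => (z + s)^-1) M.

Lemma resolvent_herm s M : 0 < s -> psdmx M ->
  (resolvent s M) ^t* = resolvent s M.
Proof.
move=> s0 pM; apply/hermP/mxfun_herm => i.
by rewrite realV ger0_real // addr_ge0 ?(ltW s0) ?psd_spectral_ge0.
Qed.

(** On each eigenvalue this is x / (x + s) = 1 - s / (x + s), where x + s > 0. *)
Lemma mulmx_resolvent s M : 0 < s -> psdmx M ->
  M *m resolvent s M = 1%:M - s *: resolvent s M.
Proof.
move=> s0 pM; have [hM _] := pM.
rewrite -[X in X *m _](mxfun_id hM) mxfunM.
have -> : mxfun (fun x => x * (x + s)^-1) M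
        = mxfun (fun x => 1 - s * (x + s)^-1) M.
  apply: eq_mxfun => i; set x := spectral_diag M 0 i.
  have xs : x + s != 0 by rewrite gt_eqF // ltr_wpDl // psd_spectral_ge0.
  by apply: (mulIf xs); rewrite mulrBl !mulfVK // mul1r addrK.
rewrite /resolvent /mxfun scalemxAl scalemxAr -(mulVmx (spectral_unit M)).
rewrite -mulmxBl -[X in _ = (X - _) *m _]mulmx1 -mulmxBr; congr (_ *m _ *m _).
by apply/matrixP => i j; rewrite !mxE mulrnBl mulrnAr.
Qed.

(* The parallel sum of [B] and [s^-1 A] when these are invertible. *)
Definition psum s A B :=
  sqrt_op A *m resolvent s (sandwich A B) *m sqrt_op A.

(** Completing the square: the left side is quadratic in [U], its value at the stationary point [V]
    is [psum s A B], and the rest is its purely quadratic part at [U - V]. *)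
Lemma psum_square s A B : psdmx A -> psdmx B -> (supp A <= supp B)%MS ->
  0 < s -> exists V, forall U,
  U ^t* *m B *m U + s^-1 *: ((1%:M - U) ^t* *m A *m (1%:M - U))
  = psum s A B + (U - V) ^t* *m B *m (U - V)
    + s^-1 *: ((U - V) ^t* *m A *m (U - V)).
Proof.
move=> pA pB sAB s0; have pM := psd_sandwich pA pB.
have sN0 : s != 0 by rewrite gt_eqF.
have hS := sqrt_op_herm pA; have SS := sqrt_opK pA; have SA := sqrt_op_sub pA.
have hK := resolvent_herm s0 pM; have MK := mulmx_resolvent s0 pM.
have [[/hermP hA _] [hB' _]] := (pA, pB); have /hermP hB := hB'.
have [b1 _ _ _] := ginv_moore_penrose hB'.
(* [B *m ginv_op B] acts as the identity on the column space of [B], which contains that of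
   [sqrt_op A] because the supports are nested. *)
have BGS : B *m ginv_op B *m sqrt_op A = sqrt_op A.
  have /submxP[D SD] : (sqrt_op A <= B)%MS.
    apply: (submx_trans SA).
    by rewrite -(supp_herm hB') -(supp_herm (proj1 pA)).
  have -> : sqrt_op A = B *m D ^t* by rewrite -[LHS]hS SD adjM hB.
  by rewrite mulmxA b1.
rewrite /psum; move: hS SS hK MK BGS; rewrite /sandwich.
move: (sqrt_op A) (ginv_op B) (resolvent _ _) => S G K hS SS hK MK BGS.
set X := S *m K *m S; have hX : X ^t* = X by rewrite /X !adjM hS hK mulmxA.
(* V is the stationary point in U: B V = s^-1 A (1 - V). *)
pose V := G *m X; exists V => U.
have BV : B *m V = X by rewrite /V /X !mulmxA BGS.
have VB : V ^t* *m B = X by rewrite -[LHS]trmxCK adjM trmxCK hB BV.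
have AW : A *m (1%:M - V) = s *: X.
  have -> : A *m (1%:M - V) = S *m (1%:M - S *m G *m S *m K) *m S.
    by rewrite !mulmxBr mulmxBl !mulmx1 SS /V /X -SS !mulmxA.
  by rewrite MK subKr -scalemxAr -scalemxAl.
have WA : (1%:M - V) ^t* *m A = s *: X.
  by rewrite -[LHS]trmxCK adjM trmxCK hA AW adjZ conj_Creal ?gtr0_real // hX.
have VX : V ^t* *m X = X *m V by rewrite -{1}BV mulmxA VB.
have eB : (U - V) ^t* *m B *m (U - V)
    = U ^t* *m B *m U - U ^t* *m X - X *m U + X *m V.
  rewrite adjB !mulmxBr !mulmxBl VB -(mulmxA _ B V) BV.
  by apply/matrixP => i j; rewrite !mxE; ring.
have eA : (U - V) ^t* *m A *m (U - V)
    = (1%:M - U) ^t* *m A *m (1%:M - U) - s *: ((1%:M - U) ^t* *m X)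
      - s *: (X *m (1%:M - U)) + s *: (X *m (1%:M - V)).
  (* In this form every product of [A] with [1%:M - V] becomes [s *: X]. *)
  have -> : U - V = (1%:M - V) - (1%:M - U).
    by rewrite opprB [RHS]addrC addrA subrK.
  move: (1%:M - V) (1%:M - U) AW WA => W Y AW WA.
  rewrite adjB !mulmxBr !mulmxBl WA -(mulmxA _ A W) AW -!scalemxAr -!scalemxAl.
  by apply/matrixP => i j; rewrite !mxE; ring.
have YX : (1%:M - U) ^t* *m X = X - U ^t* *m X.
  by rewrite adjB adj1 mulmxBl mul1mx.
rewrite eA eB !(scalerDr, scalerN, scalerA) mulVf // !scale1r YX.
rewrite !(mulmxBr X) mulmx1.
by apply/matrixP => i j; rewrite !mxE; ring.
Qed.

Lemma tr_resolvent s A B :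
  psdmx A -> \tr (A *m resolvent s (sandwich A B)) = \tr (psum s A B).
Proof.
move=> pA.
by rewrite -[X in \tr (X *m _) = _](sqrt_opK pA) -mulmxA mxtrace_mulC.
Qed.

(** The squares in [psum_square] have nonnegative trace and vanish at [U = V]. The resolvent trace
    is thus a minimum over [U] of expressions that are linear in [(A, B)] for fixed [U]. *)
Lemma tr_resolvent_min s A B : psdmx A -> psdmx B -> (supp A <= supp B)%MS ->
  0 < s ->
  (forall U, \tr (A *m resolvent s (sandwich A B))
     <= \tr (U ^t* *m B *m U) + s^-1 * \tr ((1%:M - U) ^t* *m A *m (1%:M - U)))
  /\ exists V, \tr (A *m resolvent s (sandwich A B))
     = \tr (V ^t* *m B *m V) + s^-1 * \tr ((1%:M - V) ^t* *m A *m (1%:M - V)).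
Proof.
move=> pA pB sAB s0; have [V sq] := psum_square pA pB sAB s0.
have trsq U := congr1 (fun X => \tr X) (sq U).
rewrite tr_resolvent //; split=> [U|].
  have := trsq U; rewrite !mxtraceD !mxtraceZ => ->.
  rewrite -addrA lerDl addr_ge0 ?mulr_ge0 ?psd_tr_ge0 //.
  by rewrite invr_ge0 ltW.
exists V; have := trsq V; rewrite !mxtraceD !mxtraceZ => ->.
by rewrite subrr !mulmx0 !mxtrace0 mulr0 !addr0.
Qed.

(** * Traces against functions of an operator, expanded in its eigenbasis *)

Lemma tr_mxfun A M f : \tr (A *m mxfun f M) =
  \sum_i dotmx (row i (spectralmx M) *m A) (row i (spectralmx M))
          * f (spectral_diag M 0 i).
Proof.
rewrite /mxfun !mulmxA mxtrace_mulC !mulmxA; apply: eq_bigr => i _.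
rewrite mul_mx_diag !mxE dotmxE -row_mul; congr (_ * _).
rewrite invmx_unitary ?spectral_unitarymx // !mxE; apply: eq_bigr => j _.
by rewrite !mxE.
Qed.

Lemma sum_spectral_weight A M :
  \sum_i dotmx (row i (spectralmx M) *m A) (row i (spectralmx M)) = \tr A.
Proof.
transitivity (\tr (A *m mxfun (fun=> 1) M)).
  by rewrite tr_mxfun; apply: eq_bigr => i _; rewrite mulr1.
congr (\tr _); rewrite -[RHS]mulmx1; congr (_ *m _).
rewrite /mxfun -[RHS](mulVmx (spectral_unit M)); congr (_ *m _).
suff -> : map_mx (fun=> 1) (spectral_diag M) = const_mx 1 :> 'rV[C]_n.
  by rewrite diag_const_mx mulmx1.
by apply/rowP => i; rewrite !mxE.
Qed.

(** An eigenvector of [M] for the eigenvalue 0 is killed by [M] on either side, hence by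
    [A = D *m M] in the quadratic form. *)
Lemma spectral_weight0 A M i : M \is hermsymmx -> (A <= M)%MS ->
  spectral_diag M 0 i = 0 ->
  dotmx (row i (spectralmx M) *m A) (row i (spectralmx M)) = 0.
Proof.
move=> hM /submxP[D ->] d0; have /hermP eM := hM; set q := row i _.
have qM : q *m M = 0.
  rewrite [X in _ *m X](orthomx_spectralP (hermitian_normalmx hM)) !mulmxA.
  rewrite /q -row_mul mulmxV ?spectral_unit // -row_mul mul1mx row_diag_mx.
  by rewrite d0 scale0r mul0mx.
have Mq : M *m q ^t* = 0 by rewrite -{1}eM -adjM qM trmx0 map_mx0.
by rewrite dotmxE -!mulmxA Mq !mulmx0 mxE.
Qed.

(** * Joint concavity of the resolvent trace *)

Lemma kermx_scale (a : C) A : a != 0 -> (kermx (a *: A) <= kermx A)%MS.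
Proof.
move=> a0; apply/rV_subP => u /sub_kermxP; rewrite -scalemxAr => /eqP.
by rewrite scaler_eq0 (negPf a0) /= => /eqP uA; apply/sub_kermxP.
Qed.

(** A vector killed by the combination of [B0] and [B1] is killed by each of them, hence by [A0] and
    [A1]. *)
Lemma supp_conic (a b : C) A0 A1 B0 B1 : 0 < a -> 0 < b ->
  psdmx B0 -> psdmx B1 ->
  (supp A0 <= supp B0)%MS -> (supp A1 <= supp B1)%MS ->
  (supp (a *: A0 + b *: A1) <= supp (a *: B0 + b *: B1))%MS.
Proof.
move=> a0 b0 pB0 pB1 s_0 s_1; rewrite supp_ker.
have k0 : (kermx B0 <= kermx A0)%MS by rewrite -supp_ker.
have k1 : (kermx B1 <= kermx A1)%MS by rewrite -supp_ker.
have pa := psd_scale (ltW a0) pB0; have pb := psd_scale (ltW b0) pB1.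
have ka := submx_trans (submx_trans (psd_ker_addl pa pb)
  (kermx_scale _ (lt0r_neq0 a0))) k0.
have := psd_ker_addl pb pa; rewrite addrC => kba.
have kb := submx_trans (submx_trans kba (kermx_scale _ (lt0r_neq0 b0))) k1.
apply/sub_kermxP; rewrite mulmxDr -!scalemxAr.
by move/sub_kermxP: ka => ->; move/sub_kermxP: kb => ->; rewrite !scaler0 addr0.
Qed.

(** A minimum of functions linear in the pair is concave: the minimiser [V] of the combined problem
    is tested in the two separate ones. *)
Lemma tr_resolvent_concave (a b s : C) A0 A1 B0 B1 :
  0 < a -> 0 < b -> 0 < s ->
  psdmx A0 -> psdmx A1 -> psdmx B0 -> psdmx B1 ->
  (supp A0 <= supp B0)%MS -> (supp A1 <= supp B1)%MS ->
  a * \tr (A0 *m resolvent s (sandwich A0 B0))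
  + b * \tr (A1 *m resolvent s (sandwich A1 B1))
  <= \tr ((a *: A0 + b *: A1) *m
            resolvent s (sandwich (a *: A0 + b *: A1) (a *: B0 + b *: B1))).
Proof.
move=> a0 b0 s0 pA0 pA1 pB0 pB1 s_0 s_1.
set A := a *: A0 + b *: A1; set B := a *: B0 + b *: B1.
have pA : psdmx A by apply: psd_add; apply: psd_scale => //; exact: ltW.
have pB : psdmx B by apply: psd_add; apply: psd_scale => //; exact: ltW.
have sAB : (supp A <= supp B)%MS by exact: supp_conic.
have [_ [V eV]] := tr_resolvent_min pA pB sAB s0; rewrite [leRHS]eV.
have [/(_ V) le0 _] := tr_resolvent_min pA0 pB0 s_0 s0.
have [/(_ V) le1 _] := tr_resolvent_min pA1 pB1 s_1 s0.
rewrite -(ler_pM2l a0) in le0; rewrite -(ler_pM2l b0) in le1.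
(* What remains is an equality, by linearity of the objective at fixed [V]. *)
apply: le_trans (lerD le0 le1) _; rewrite le_eqVlt; apply/orP; left; apply/eqP.
have trC (U X Y : 'M[C]_n) : \tr (U ^t* *m (a *: X + b *: Y) *m U)
    = a * \tr (U ^t* *m X *m U) + b * \tr (U ^t* *m Y *m U).
  rewrite mulmxDr mulmxDl -2!scalemxAr -2!scalemxAl mxtraceD.
  by rewrite mxtraceZ; congr (_ + _); rewrite mxtraceZ.
rewrite /A /B 2!trC; ring.
Qed.

End PositiveOperators.

(** * The relative entropy as a sum over a finite spectral measure *)

Section SpectralMeasure.
Variables (R : realType) (n : nat).
Implicit Types A B : 'M[R[i]]_n.

(** The [mu i] are the eigenvalues of the sandwich and the [w i] the values of the quadratic form of
    [A] at its eigenvectors. One measure serves both the logarithm and all resolvents, and it gives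
    no weight to the eigenvalue 0, where [ln] takes a default value. *)
Lemma spectral_measure A B : psdmx A -> psdmx B -> (supp A <= supp B)%MS ->
  exists w mu : 'I_n -> R,
  [/\ forall i, w i != 0 -> 0 < mu i,
      \tr A = (\sum_i w i)%:C,
      DR A B = (\sum_i w i * ln (mu i))%:E
    & forall s, 0 < s -> \tr (A *m resolvent s%:C (sandwich A B))
                       = (\sum_i w i / (mu i + s))%:C].
Proof.
move=> pA pB sAB; pose M := sandwich A B.
have pM : psdmx M := psd_sandwich pA pB; have [hM _] := pM.
pose q i := row i (spectralmx M).
pose w i := complex.Re (dotmx (q i *m A) (q i)).
pose mu i := complex.Re (spectral_diag M 0 i).
have wE i : dotmx (q i *m A) (q i) = (w i)%:C.
  by rewrite RRe_real // ger0_real //; case: pA.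
have muE i : spectral_diag M 0 i = (mu i)%:C.
  by rewrite RRe_real // ger0_real // psd_spectral_ge0.
have AM : (A <= M)%MS.
  by rewrite -(supp_herm (proj1 pA)) -(supp_sandwich pA pB sAB) supp_herm.
exists w, mu; split.
- move=> i; apply: contra_neqT; rewrite -leNgt => mu_le0.
  have mu0 : spectral_diag M 0 i = 0.
    by apply/le_anti; rewrite psd_spectral_ge0 // muE lecR mu_le0.
  by rewrite /w /q spectral_weight0.
- rewrite -(sum_spectral_weight A M) rmorph_sum.
  by apply: eq_bigr => i _; exact: wE.
- have -> : DR A B = (complex.Re (\tr (A *m ln_op M)))%:E by rewrite /DR sAB.
  suff -> : \tr (A *m ln_op M) = (\sum_i w i * ln (mu i))%:C by [].
  rewrite tr_mxfun rmorph_sum; apply: eq_bigr => i _.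
  by rewrite rmorphM -[RHS]/((w i)%:C * (ln (mu i))%:C) -wE.
- move=> s s0; rewrite tr_mxfun rmorph_sum; apply: eq_bigr => i _.
  by rewrite wE muE rmorphM fmorphV rmorphD.
Qed.

End SpectralMeasure.

(** * Weighted sums of logarithms *)

Section LogSum.
Import numFieldNormedType.Exports.
Variable R : realType.
Implicit Types t : seq (R * R).

Lemma is_derive_ln_sum t (s : R) : 0 <= s ->
  {in t, forall p, p.1 != 0 -> 0 < p.2} ->
  is_derive s 1 (fun s => \sum_(p <- t) p.1 * ln (p.2 + s))
    (\sum_(p <- t) p.1 / (p.2 + s)).
Proof.
move=> s0; elim: t => [|[c l] t IH] tP.
  rewrite big_nil.
  by under eq_fun do rewrite big_nil; exact: is_derive_cst.
rewrite big_cons /=; under eq_fun do rewrite big_cons /=.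
have {}IH := IH (fun p pt => tP p (@mem_behead _ ((c, l) :: t) p pt)).
apply: (is_deriveD _ IH).
(* For c = 0 the sign of l + s is unknown, but the term and its claimed derivative are both
   identically 0. *)
have [->|c0] := eqVneq c 0.
  rewrite mul0r; under eq_fun do rewrite mul0r; exact: is_derive_cst.
have ls : 0 < l + s by rewrite ltr_wpDr // (tP (c, l)) ?mem_head.
apply: is_deriveZ.
have : is_derive s 1 (fun s : R => l + s) (0 + 1) by apply: is_deriveD.
rewrite add0r => lsD.
rewrite -[X in is_derive _ _ _ X]mulr1.
exact: (is_derive1_comp (is_derive1_ln ls)).
Qed.

Lemma ln_sum_le0 t :
  {in t, forall p, p.1 != 0 -> 0 < p.2} -> \sum_(p <- t) p.1 = 0 ->
  (forall s, 0 < s -> 0 <= \sum_(p <- t) p.1 / (p.2 + s)) ->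
  \sum_(p <- t) p.1 * ln p.2 <= 0.
Proof.
move=> tP t0 tge; pose f s := \sum_(p <- t) p.1 * ln (p.2 + s).
have f0 : f 0 = \sum_(p <- t) p.1 * ln p.2.
  by apply: eq_bigr => p _; rewrite addr0.
have fD (s : R) : 0 <= s -> is_derive s 1 f (\sum_(p <- t) p.1 / (p.2 + s)).
  by move=> s0; exact: is_derive_ln_sum.
have f_mono (s : R) : 0 <= s -> f 0 <= f s.
  move=> s0; apply: (@ger0_derive1_ndecry _ f 0) => // [x|x|].
  - by rewrite in_itv/= andbT => /ltW/fD [].
  - rewrite in_itv/= andbT => x0; rewrite derive1E.
    by have [_ ->] := fD x (ltW x0); exact: tge.
  - apply: derivable_within_continuous => x.
    by rewrite in_itv/= andbT => /fD [].
pose K := \sum_(p <- t) `|p.1 * p.2|.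
have K0 : 0 <= K by apply: sumr_ge0.
(* As the weights sum to 0, ln s may be subtracted from every logarithm: f s is the sum of the c ln
   (1 + l / s), and ln (1 + x) <= x bounds each term by |c l| / s. *)
have f_le (s : R) : 0 < s -> f s <= K / s.
  move=> s0; rewrite -[f s]subr0 -[X in _ - X](mul0r (ln s)) -t0 !mulr_suml.
  rewrite -sumrB 2!big_seq; apply: ler_sum => -[c l] ct /=.
  have [->|c0] := eqVneq c 0; first by rewrite !mul0r subrr normr0 mul0r.
  have l0 : 0 < l := tP _ ct c0.
  have ls : 0 < l / s by rewrite divr_gt0.
  rewrite -mulrBr -lnV -?lnM ?posrE ?invr_gt0 ?addr_gt0 //.
  rewrite mulrDl divff ?gt_eqF // [_ + 1]addrC.
  rewrite (le_trans (ler_norm _)) // !normrM (gtr0_norm l0) -mulrA.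
  rewrite ler_wpM2l // ger0_norm; last by rewrite ln_ge0 ?lerDl ?(ltW ls).
  by apply: le_ln1Dx; rewrite (lt_trans _ ls) // ltrN10.
rewrite -f0 leNgt; apply/negP => f_gt0.
(* At this s, f 0 <= f s <= K / s would give K + 1 <= K. *)
have s0 : 0 < (K + 1) / f 0 by rewrite divr_gt0 // ltr_wpDl.
have := le_trans (f_mono _ (ltW s0)) (f_le _ s0).
rewrite ler_pdivlMr // mulrCA divff ?gt_eqF // mulr1.
by rewrite leNgt ltrDl ltr01.
Qed.

End LogSum.

(** * Joint sublinearity and joint convexity of the relative entropy *)

Section JointConvexity.
Variables (R : realType) (n : nat).
Implicit Types A B : 'M[R[i]]_n.

Lemma DR_jointly_sublinear (a b : R) A0 A1 B0 B1 : 0 < a -> 0 < b ->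
  psdmx A0 -> psdmx A1 -> psdmx B0 -> psdmx B1 ->
  (DR (a%:C *: A0 + b%:C *: A1) (a%:C *: B0 + b%:C *: B1)
   <= a%:E * DR A0 B0 + b%:E * DR A1 B1)%E.
Proof.
move=> a0 b0 pA0 pA1 pB0 pB1.
have DRNy A B : DR A B != -oo%E by rewrite /DR; case: ifP.
have mulNy (c : R) A B : 0 < c -> (c%:E * DR A B)%E != -oo%E.
  by rewrite /DR; case: ifP => // _ c0; rewrite gt0_muley.
(* If one entropy on the right is +oo, so is the whole right side, because the other term is not
   -oo. *)
have [s_0|/negPf n0] := boolP (supp A0 <= supp B0)%MS; last first.
  have -> : DR A0 B0 = +oo%E by rewrite /DR n0.
  by rewrite gt0_muley ?lte_fin // addye ?leey ?mulNy.
have [s_1|/negPf n1] := boolP (supp A1 <= supp B1)%MS; last first.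
  have -> : DR A1 B1 = +oo%E by rewrite /DR n1.
  by rewrite gt0_muley ?lte_fin // addey ?leey ?mulNy.
have aC : 0 < a%:C by rewrite ltcR.
have bC : 0 < b%:C by rewrite ltcR.
have ss := supp_conic aC bC pB0 pB1 s_0 s_1.
have conc s (s0 : 0 < s) :=
  tr_resolvent_concave aC bC s0 pA0 pA1 pB0 pB1 s_0 s_1.
have pA : psdmx (a%:C *: A0 + b%:C *: A1).
  by apply: psd_add; apply: psd_scale => //; exact: ltW.
have pB : psdmx (a%:C *: B0 + b%:C *: B1).
  by apply: psd_add; apply: psd_scale => //; exact: ltW.
have [w [mu [mu_gt0 trA -> tr_res]]] := spectral_measure pA pB ss.
have [w0 [mu0 [mu0_gt0 trA0 -> tr_res0]]] := spectral_measure pA0 pB0 s_0.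
have [w1 [mu1 [mu1_gt0 trA1 -> tr_res1]]] := spectral_measure pA1 pB1 s_1.
rewrite -!EFinM -EFinD lee_fin -subr_ge0 -oppr_le0.
(* The signed measure of the convexity defect: the combined pair counts positively, the two given
   pairs negatively with factors a and b. *)
pose t := [seq (w i, mu i) | i <- index_enum 'I_n]
  ++ [seq (- (a * w0 i), mu0 i) | i <- index_enum 'I_n]
  ++ [seq (- (b * w1 i), mu1 i) | i <- index_enum 'I_n].
(* Used with f = [ln] for the entropies, with f = 1 for the total weight, which is 0 by linearity of
   the trace, and with f x = (x + s)^-1 for the concavity of the resolvent traces. *)
have sum_t f : \sum_(p <- t) p.1 * f p.2 = \sum_i w i * f (mu i)
    - (a * (\sum_i w0 i * f (mu0 i)) + b * (\sum_i w1 i * f (mu1 i))).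
  rewrite /t !big_cat !big_map /= opprD !mulr_sumr -!sumrN.
  by congr (_ + (_ + _)); apply: eq_bigr => i _; rewrite mulNr mulrA.
rewrite opprB -sum_t; apply: ln_sum_le0 => [p||s s0].
- rewrite !mem_cat => /or3P[] /mapP[i _ ->] /=; first exact: mu_gt0.
    by rewrite oppr_eq0 mulf_eq0 negb_or => /andP[_]; exact: mu0_gt0.
  by rewrite oppr_eq0 mulf_eq0 negb_or => /andP[_]; exact: mu1_gt0.
- have sum1 (I : Type) (r : seq I) (v : I -> R) :
      \sum_(i <- r) v i * 1 = \sum_(i <- r) v i.
    by apply: eq_bigr => i _; rewrite mulr1.
  rewrite -sum1 (sum_t (fun=> 1)) !sum1; apply/eqP.
  rewrite subr_eq0 -(inj_eq (@complexI R)).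
  rewrite rmorphD !rmorphM /= -trA -trA0 -trA1.
  by rewrite mxtraceD !mxtraceZ.
- rewrite (sum_t (fun x => (x + s)^-1)) subr_ge0 -lecR rmorphD !rmorphM /=.
  rewrite -tr_res // -tr_res0 // -tr_res1 //; apply: conc.
  by rewrite ltcR.
Qed.

End JointConvexity.

Theorem theorem4p4 (R : realType) (n : nat)
    (rho0 rho1 sigma0 sigma1 : 'M[R[i]]_n) (lambda : R) :
  density_operator rho0 -> density_operator rho1 ->
  density_operator sigma0 -> density_operator sigma1 ->
  0 <= lambda <= 1 ->
  (lambda%:E * DR rho0 sigma0 + (1 - lambda)%:E * DR rho1 sigma1
   >= DR (lambda%:C *: rho0 + (1 - lambda)%:C *: rho1)
         (lambda%:C *: sigma0 + (1 - lambda)%:C *: sigma1))%E.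
Proof.
move=> [p0 _] [p1 _] [q0 _] [q1 _] /andP[l0 l1].
(* Sublinearity is stated for positive coefficients. At the endpoints the term with coefficient 0
   vanishes even when its entropy is infinite, by [mul0e]. *)
have [->|lN0] := eqVneq lambda 0.
  by rewrite !scale0r !add0r subr0 !scale1r mul0e add0e mul1e.
have [->|lN1] := eqVneq lambda 1.
  by rewrite subrr !scale0r !addr0 !scale1r mul0e adde0 mul1e.
apply: DR_jointly_sublinear => //; last by rewrite subr_gt0 lt_neqAle lN1.
by rewrite lt_neqAle eq_sym lN0.
Qed.
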